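(* Let $R$ be a commutative artinian ring, let $(\mathcal C,\mathbb E,\mathfrak s)$ be an artin extriangulated $R$-category with enough projectives and enough injectives, and let $\Theta=\{\Theta(1),\Theta(2),\dots,\Theta(n)\}$ be a family of objects in $\mathcal C$ such that $\mathbb E(\Theta(j),\Theta(i))=0$ for all $j\ge i$. Then the subcategory $\mathfrak F(\Theta)$ of $\Theta$-filtered objects is functorially finite in $\mathcal C$.
   Context: **Extriangulated categories (Nakaoka–Palu).** Let $\mathcal C$ be an additive category and $\mathbb E:\mathcal C^{\mathrm{op}}\times\mathcal C\to \mathrm{Ab}$ a biadditive functor. An element $\delta\in\mathbb E(C,A)$ is an $\mathbb E$-extension; for $a:A\to A'$ and $c:C'\to C$ write $a_*\delta=\mathbb E(C,a)(\delta)$, $c^*\delta=\mathbb E(c,A)(\delta)$. For $\delta\in\mathbb E(C,A)$, $\delta'\in\mathbb E(C',A')$, a morphism $(a,c):\delta\to\delta'$ is a pair $a:A\to A'$, $c:C\to C'$ with $a_*\delta=c^*\delta'$; $\delta\oplus\delta'\in\mathbb E(C\oplus C',A\oplus A')$ is the element with components $(\delta,0,0,\delta')$ in $\mathbb E(C,A)\oplus\mathbb E(C,A')\oplus\mathbb E(C',A)\oplus\mathbb E(C',A')$. Sequences $A\xrightarrow{x}B\xrightarrow{y}C$ and $A\xrightarrow{x'}B'\xrightarrow{y'}C$ are equivalent if there is an isomorphism $b:B\to B'$ with $bx=x'$, $y'b=y$; $[A\to B\to C]$ denotes the equivalence class. A realization $\mathfrak s$ assigns to each $\delta\in\mathbb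 E(C,A)$ a class $\mathfrak s(\delta)=[A\xrightarrow{x}B\xrightarrow{y}C]$ such that for every morphism $(a,c):\delta\to\delta'$, with $\mathfrak s(\delta')=[A'\xrightarrow{x'}B'\xrightarrow{y'}C']$, there is $b:B\to B'$ with $bx=x'a$, $y'b=cy$. It is additive if $\mathfrak s(0)=[A\to A\oplus C\to C]$ (canonical maps) and $\mathfrak s(\delta\oplus\delta')=\mathfrak s(\delta)\oplus\mathfrak s(\delta')$. $(\mathcal C,\mathbb E,\mathfrak s)$ is an extriangulated category if: (ET1) $\mathbb E$ is biadditive; (ET2) $\mathfrak s$ is an additive realization; (ET3) if $\mathfrak s(\delta)=[A\xrightarrow{x}B\xrightarrow{y}C]$, $\mathfrak s(\delta')=[A'\xrightarrow{x'}B'\xrightarrow{y'}C']$ and $bx=x'a$, then there is $c:C\to C'$ with $(a,c):\delta\to\delta'$ a morphism and $cy=y'b$; (ET4) if $\delta\in\mathbb E(D,A)$, $\delta'\in\mathbb E(F,B)$ are realized by $A\xrightarrow{f}B\xrightarrow{f'}D$ and $B\xrightarrow{g}C\xrightarrow{g'}F$, there are an object $E$, morphisms $h=gf:A\to C$, $h':C\to E$, $d:D\to E$, $e:E\to F$ with $h'g=df'$, $eh'=g'$, and $\delta''\in\mathbb E(E,A)$ realized by $A\xrightarrow{h}C\xrightarrow{h'}E$, such that $D\xrightarrow{d}E\xrightarrow{e}F$ realizes $f'_*\delta'$, $d^*\delta''=\delta$ and $f_*\delta''=e^*\delta'$; and (ET3)$^{\mathrm{op}}$, (ET4)$^{\mathrm{op}}$,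 the duals of (ET3), (ET4) (obtained by passing to the opposite category). An $\mathbb E$-triangle $A\to B\to C\dashrightarrow$ is a sequence realizing some $\delta\in\mathbb E(C,A)$. **Enough projectives/injectives.** $P$ is projective if for every $\mathbb E$-triangle $A\to B\xrightarrow{y}C\dashrightarrow$ every $P\to C$ factors through $y$. $\mathcal C$ has enough projectives if every $C$ admits an $\mathbb E$-triangle $A\to P\to C\dashrightarrow$ with $P$ projective. Injectives and enough injectives are defined dually. **Artin extriangulated $R$-category.** An extriangulated category which is an $R$-category (Hom sets are $R$-modules, composition is $R$-bilinear), with $\mathbb E$ an $R$-bilinear functor into $R$-modules, such that all $\mathrm{Hom}_{\mathcal C}(X,Y)$ and all $\mathbb E(X,Y)$ are finitely generated $R$-modules, and $\mathcal C$ is Krull–Schmidt (every object is a finite direct sum of objects with local endomorphism rings). **Filtered objects.** For a class $\mathcal X$ of objects, $\mathfrak F(\mathcal X)$ is the class (full subcategory) of objects $M$ admitting an $\mathcal X$-filtration: a family of $\mathbb E$-triangles $\{M_{i-1}\to M_i\to X_i\dashrightarrow\}_{i=0}^{m}$ with $M_{-1}=0=X_0$, $M_m=M$ and $X_i\in\mathcal X$ for $i\ge1$. **Functorially finite.** An $\mathcal X$-precover of $C$ is a morphism $f:X\to C$ with $X\in\mathcal X$ such that $\mathrm{Hom}_{\mathcal C}(X',X)\to\mathrm{Hom}_{\mathcal C}(X',C)$ is surjective for all $X'\in\mathcal X$; $\mathcal X$ is precovering in $\mathcal C$ if every object of $\mathcal C$ has an $\mathcal X$-precover. $\mathcal X$-preenvelopes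 and preenveloping classes are defined dually. $\mathcal X$ is functorially finite in $\mathcal C$ if it is both precovering and preenveloping. *)

(* Defs.v *)
From HB Require Import structures.
From mathcomp Require Import all_boot all_algebra.

Set Implicit Arguments.
Unset Strict Implicit.
Unset Printing Implicit Defensive.

Import GRing.Theory.
Local Open Scope ring_scope.

Declare Scope cat_scope.
Delimit Scope cat_scope with cat.
Local Open Scope cat_scope.

Definition is_ideal (R : comPzRingType) (I : R -> Prop) : Prop :=
  [/\ I 0, (forall x y, I x -> I y -> I (x + y)) &
      (forall r x, I x -> I (r * x))].

Definition artinian (R : comPzRingType) : Prop :=
  forall I : nat -> R -> Prop,
    (forall k, is_ideal (I k)) ->
    (forall k x, I k.+1 x -> I k x) ->
    exists N, forall k, (N <= k)%N -> forall x, I k x <-> I N x.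

Definition finitely_generated (R : comPzRingType) (M : lmodType R) : Prop :=
  exists (n : nat) (v : 'I_n -> M),
    forall m : M, exists r : 'I_n -> R, m = \sum_(i < n) r i *: v i.

Record rcategory (R : comPzRingType) := RCategory {
  obj :> Type;
  mor : obj -> obj -> lmodType R;
  idmor : forall X : obj, mor X X;
  compose : forall X Y Z : obj, mor Y Z -> mor X Y -> mor X Z;
  composeA : forall (W X Y Z : obj) (h : mor Y Z) (g : mor X Y) (f : mor W X),
    compose h (compose g f) = compose (compose h g) f;
  compose1m : forall (X Y : obj) (f : mor X Y), compose (idmor Y) f = f;
  composem1 : forall (X Y : obj) (f : mor X Y), compose f (idmor X) = f;
  compose_linear_l : forall (X Y Z : obj) (f : mor X Y),
    linear (fun g : mor Y Z => compose g f);
  compose_linear_r : forall (X Y Z : obj) (g : mor Y Z),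
    linear (fun f : mor X Y => compose g f)
}.

Arguments mor {R C} X Y : rename.
Arguments idmor {R C} X : rename.
Arguments compose {R C X Y Z} g f : rename.

Notation "g ∘ f" := (compose g f) (at level 40, left associativity) : cat_scope.

Definition op_cat (R : comPzRingType) (C : rcategory R) : rcategory R :=
  @RCategory R C (fun X Y => @mor R C Y X) (fun X => idmor X)
    (fun X Y Z (g : @mor R C Z Y) (f : @mor R C Y X) => f ∘ g)
    (fun W X Y Z h g f => esym (composeA f g h))
    (fun X Y f => composem1 f) (fun X Y f => compose1m f)
    (fun X Y Z f => @compose_linear_r R C Z Y X f)
    (fun X Y Z g => @compose_linear_l R C Z Y X g).

Definition is_iso (R : comPzRingType) (C : rcategory R) (X Y : C)
    (f : mor X Y) : Prop :=
  exists g : mor Y X, g ∘ f = idmor X /\ f ∘ g = idmor Y.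

Definition is_zero_object (R : comPzRingType) (C : rcategory R) (Z : C) : Prop :=
  forall X : C, (forall f g : mor Z X, f = g) /\ (forall f g : mor X Z, f = g).

Record biproduct (R : comPzRingType) (C : rcategory R) (X1 X2 : C) := Biproduct {
  bp_obj :> C;
  in1 : mor X1 bp_obj;
  in2 : mor X2 bp_obj;
  pr1 : mor bp_obj X1;
  pr2 : mor bp_obj X2;
  pr1_in1 : pr1 ∘ in1 = idmor X1;
  pr2_in2 : pr2 ∘ in2 = idmor X2;
  pr1_in2 : pr1 ∘ in2 = 0;
  pr2_in1 : pr2 ∘ in1 = 0;
  in_pr : in1 ∘ pr1 + in2 ∘ pr2 = idmor bp_obj
}.

Arguments in1 {R C X1 X2} S : rename.
Arguments in2 {R C X1 X2} S : rename.
Arguments pr1 {R C X1 X2} S : rename.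
Arguments pr2 {R C X1 X2} S : rename.

Definition hom_sum (R : comPzRingType) (C : rcategory R) (X1 X2 Y1 Y2 : C)
    (S : biproduct X1 X2) (T : biproduct Y1 Y2)
    (f1 : mor X1 Y1) (f2 : mor X2 Y2) : mor S T :=
  in1 T ∘ f1 ∘ pr1 S + in2 T ∘ f2 ∘ pr2 S.

Definition additive_category (R : comPzRingType) (C : rcategory R) : Prop :=
  (exists Z : C, is_zero_object Z) /\
  (forall X1 X2 : C, inhabited (biproduct X1 X2)).

(* [is_direct_sum Y X]: X is a direct sum of Y 0, ..., Y (n - 1); the empty
   direct sum (n = 0) is a zero object. *)
Definition is_direct_sum (R : comPzRingType) (C : rcategory R) (n : nat)
    (Y : 'I_n -> C) (X : C) : Prop :=
  exists (i : forall k, mor (Y k) X) (p : forall k, mor X (Y k)),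
    [/\ (forall k, p k ∘ i k = idmor (Y k)),
        (forall k l, k != l -> p k ∘ i l = 0) &
        \sum_(k < n) i k ∘ p k = idmor X].

(* A ring is local when it is nonzero and a sum of two non-units is a non-unit;
   the units of the endomorphism ring are the automorphisms. *)
Definition has_local_End (R : comPzRingType) (C : rcategory R) (X : C) : Prop :=
  idmor X <> 0 /\
  (forall f g : mor X X, ~ is_iso f -> ~ is_iso g -> ~ is_iso (f + g)).

Definition krull_schmidt (R : comPzRingType) (C : rcategory R) : Prop :=
  forall X : C, exists (n : nat) (Y : 'I_n -> C),
    (forall k, has_local_End (Y k)) /\ is_direct_sum Y X.

(* R-bilinear functors C^op x C -> Mod R; [Emap c a] is E(c, a). *)
Record bifunctor (R : comPzRingType) (C : rcategory R) := Bifunctor {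
  Ext :> C -> C -> lmodType R;
  Emap : forall Z Z' A A' : C, mor Z' Z -> mor A A' -> Ext Z A -> Ext Z' A';
  Emap_id : forall (Z A : C) (d : Ext Z A), Emap (idmor Z) (idmor A) d = d;
  Emap_comp : forall (Z Z' Z'' A A' A'' : C) (c : mor Z' Z) (c' : mor Z'' Z')
      (a : mor A A') (a' : mor A' A'') (d : Ext Z A),
    Emap (c ∘ c') (a' ∘ a) d = Emap c' a' (Emap c a d);
  Emap_linear : forall (Z Z' A A' : C) (c : mor Z' Z) (a : mor A A'),
    linear (Emap c a);
  Emap_linear_l : forall (Z Z' A A' : C) (a : mor A A') (d : Ext Z A),
    linear (fun c : mor Z' Z => Emap c a d);
  Emap_linear_r : forall (Z Z' A A' : C) (c : mor Z' Z) (d : Ext Z A),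
    linear (fun a : mor A A' => Emap c a d)
}.

Arguments Emap {R C} E {Z Z' A A'} c a d : rename.

Definition op_bifunctor (R : comPzRingType) (C : rcategory R)
    (E : bifunctor C) : bifunctor (op_cat C) :=
  @Bifunctor R (op_cat C) (fun Z A => E A Z)
    (fun Z Z' A A' (c : @mor R C Z Z') (a : @mor R C A' A) (d : E A Z) =>
       Emap E a c d)
    (fun Z A d => @Emap_id R C E A Z d)
    (fun Z Z' Z'' A A' A'' c c' a a' d => @Emap_comp R C E A A' A'' Z Z' Z'' a a' c c' d)
    (fun Z Z' A A' c a => @Emap_linear R C E A A' Z Z' a c)
    (fun Z Z' A A' a d => @Emap_linear_r R C E A A' Z Z' a d)
    (fun Z Z' A A' c d => @Emap_linear_l R C E A A' Z Z' c d).

Definition push (R : comPzRingType) (C : rcategory R) (E : bifunctor C)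
    (Z A A' : C) (a : mor A A') (d : E Z A) : E Z A' := Emap E (idmor Z) a d.

Definition pull (R : comPzRingType) (C : rcategory R) (E : bifunctor C)
    (Z Z' A : C) (c : mor Z' Z) (d : E Z A) : E Z' A := Emap E c (idmor A) d.

Definition ext_morphism (R : comPzRingType) (C : rcategory R) (E : bifunctor C)
    (A Z A' Z' : C) (d : E Z A) (d' : E Z' A') (a : mor A A') (c : mor Z Z') :
    Prop :=
  push a d = pull c d'.

(* [is_ext_sum SZ SA d d' e]: e is the extension d (+) d', that is, the element
   of E(Z (+) Z', A (+) A') with components d, 0, 0, d' in E(Z, A), E(Z, A'),
   E(Z', A), E(Z', A'). *)
Definition is_ext_sum (R : comPzRingType) (C : rcategory R) (E : bifunctor C)
    (A Z A' Z' : C) (SZ : biproduct Z Z') (SA : biproduct A A')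
    (d : E Z A) (d' : E Z' A') (e : E SZ SA) : Prop :=
  [/\ Emap E (in1 SZ) (pr1 SA) e = d, Emap E (in1 SZ) (pr2 SA) e = 0,
      Emap E (in2 SZ) (pr1 SA) e = 0 & Emap E (in2 SZ) (pr2 SA) e = d'].

Definition seq_equiv (R : comPzRingType) (C : rcategory R) (A Z B B' : C)
    (x : mor A B) (y : mor B Z) (x' : mor A B') (y' : mor B' Z) : Prop :=
  exists b : mor B B', [/\ is_iso b, b ∘ x = x' & y' ∘ b = y].

(* A set of sequences A -> B -> Z attached to each extension in E(Z, A):
   [s A B Z d x y] says that (x, y) belongs to the set attached to d. When these
   sets are equivalence classes it reads s(d) = [A -x-> B -y-> Z]. *)
Definition prerealization (R : comPzRingType) (C : rcategory R)
    (E : bifunctor C) : Type :=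
  forall A B Z : C, E Z A -> mor A B -> mor B Z -> Prop.

Definition op_prerealization (R : comPzRingType) (C : rcategory R)
    (E : bifunctor C) (s : prerealization E) : prerealization (op_bifunctor E) :=
  fun A B Z (d : E A Z) (x : @mor R C B A) (y : @mor R C Z B) => s Z B A d y x.

Definition is_realization (R : comPzRingType) (C : rcategory R)
    (E : bifunctor C) (s : prerealization E) : Prop :=
  (forall (A Z : C) (d : E Z A),
     exists (B0 : C) (x0 : mor A B0) (y0 : mor B0 Z),
       forall (B : C) (x : mor A B) (y : mor B Z),
         s A B Z d x y <-> seq_equiv x0 y0 x y) /\
  (forall (A B Z A' B' Z' : C) (d : E Z A) (d' : E Z' A')
      (x : mor A B) (y : mor B Z) (x' : mor A' B') (y' : mor B' Z')
      (a : mor A A') (c : mor Z Z'),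
     s A B Z d x y -> s A' B' Z' d' x' y' -> ext_morphism d d' a c ->
     exists b : mor B B', b ∘ x = x' ∘ a /\ y' ∘ b = c ∘ y).

Definition is_additive_realization (R : comPzRingType) (C : rcategory R)
    (E : bifunctor C) (s : prerealization E) : Prop :=
  [/\ is_realization s,
      (forall (A Z : C) (S : biproduct A Z), s A S Z 0 (in1 S) (pr2 S)) &
      (forall (A B Z A' B' Z' : C) (d : E Z A) (d' : E Z' A')
          (x : mor A B) (y : mor B Z) (x' : mor A' B') (y' : mor B' Z')
          (SA : biproduct A A') (SB : biproduct B B') (SZ : biproduct Z Z')
          (e : E SZ SA),
         s A B Z d x y -> s A' B' Z' d' x' y' -> is_ext_sum d d' e ->
         s SA SB SZ e (hom_sum SA SB x x') (hom_sum SB SZ y y'))].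

Definition ET3 (R : comPzRingType) (C : rcategory R)
    (E : bifunctor C) (s : prerealization E) : Prop :=
  forall (A B Z A' B' Z' : C) (d : E Z A) (d' : E Z' A')
      (x : mor A B) (y : mor B Z) (x' : mor A' B') (y' : mor B' Z')
      (a : mor A A') (b : mor B B'),
    s A B Z d x y -> s A' B' Z' d' x' y' -> b ∘ x = x' ∘ a ->
    exists c : mor Z Z', ext_morphism d d' a c /\ c ∘ y = y' ∘ b.

Definition ET4 (R : comPzRingType) (C : rcategory R)
    (E : bifunctor C) (s : prerealization E) : Prop :=
  forall (A B D X F : C) (d1 : E D A) (d2 : E F B)
      (f : mor A B) (f' : mor B D) (g : mor B X) (g' : mor X F),
    s A B D d1 f f' -> s B X F d2 g g' ->
    exists (Y : C) (h' : mor X Y) (d : mor D Y) (e : mor Y F) (d3 : E Y A),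
      [/\ h' ∘ g = d ∘ f' /\ e ∘ h' = g',
          s A X Y d3 (g ∘ f) h',
          s D Y F (push f' d2) d e,
          pull d d3 = d1 &
          push f d3 = pull e d2].

(* With R = int these are the extriangulated categories of Nakaoka and Palu; for
   general R, the Hom groups and E carry compatible R-module structures. *)
Record extriangulated_category (R : comPzRingType) := ExtriangulatedCategory {
  et_cat :> rcategory R;
  et_ext : bifunctor et_cat;
  et_real : prerealization et_ext;
  et_additive : additive_category et_cat;
  et_ET2 : is_additive_realization et_real;
  et_ET3 : ET3 et_real;
  et_ET4 : ET4 et_real;
  et_ET3_op : ET3 (op_prerealization et_real);
  et_ET4_op : ET4 (op_prerealization et_real)
}.

Definition E_triangle (R : comPzRingType) (C : extriangulated_category R)
    (A B Z : C) (x : mor A B) (y : mor B Z) : Prop :=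
  exists d : et_ext C Z A, @et_real R C A B Z d x y.

Definition projective (R : comPzRingType) (C : extriangulated_category R)
    (P : C) : Prop :=
  forall (A B Z : C) (x : mor A B) (y : mor B Z), E_triangle x y ->
    forall f : mor P Z, exists g : mor P B, y ∘ g = f.

Definition injective_object (R : comPzRingType) (C : extriangulated_category R)
    (I : C) : Prop :=
  forall (A B Z : C) (x : mor A B) (y : mor B Z), E_triangle x y ->
    forall f : mor A I, exists g : mor B I, g ∘ x = f.

Definition enough_projectives (R : comPzRingType)
    (C : extriangulated_category R) : Prop :=
  forall Z : C, exists (A P : C) (x : mor A P) (y : mor P Z),
    projective P /\ E_triangle x y.

Definition enough_injectives (R : comPzRingType)
    (C : extriangulated_category R) : Prop :=
  forall A : C, exists (I Z : C) (x : mor A I) (y : mor I Z),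
    injective_object I /\ E_triangle x y.

Definition is_artin (R : comPzRingType) (C : extriangulated_category R) : Prop :=
  [/\ (forall X Y : C, finitely_generated (@mor R C X Y)),
      (forall X Y : C, finitely_generated (et_ext C X Y)) &
      krull_schmidt C].

(* N k stands for M_{k-1}, so that N 0 = M_{-1} and N (m + 1) = M_m = M. *)
Definition filtered (R : comPzRingType) (C : extriangulated_category R)
    (XX : C -> Prop) (M : C) : Prop :=
  exists (m : nat) (N X : nat -> C),
    [/\ is_zero_object (N 0%N), is_zero_object (X 0%N), N m.+1 = M,
        (forall i, (0 < i <= m)%N -> XX (X i)) &
        (forall i, (i <= m)%N ->
           exists (x : mor (N i) (N i.+1)) (y : mor (N i.+1) (X i)),
             E_triangle x y)].

Definition family_class (R : comPzRingType) (C : rcategory R) (n : nat)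
    (Theta : 'I_n -> C) : C -> Prop :=
  fun X => exists i, X = Theta i.

Definition is_precover (R : comPzRingType) (C : rcategory R) (XX : C -> Prop)
    (X Z : C) (f : mor X Z) : Prop :=
  XX X /\
  (forall X' : C, XX X' -> forall g : mor X' Z, exists h : mor X' X, f ∘ h = g).

Definition is_preenvelope (R : comPzRingType) (C : rcategory R)
    (XX : C -> Prop) (A X : C) (f : mor A X) : Prop :=
  XX X /\
  (forall X' : C, XX X' -> forall g : mor A X', exists h : mor X X', h ∘ f = g).

Definition precovering (R : comPzRingType) (C : rcategory R)
    (XX : C -> Prop) : Prop :=
  forall Z : C, exists (X : C) (f : mor X Z), is_precover XX f.

Definition preenveloping (R : comPzRingType) (C : rcategory R)
    (XX : C -> Prop) : Prop :=
  forall A : C, exists (X : C) (f : mor A X), is_preenvelope XX f.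

Definition functorially_finite (R : comPzRingType) (C : rcategory R)
    (XX : C -> Prop) : Prop :=
  precovering XX /\ preenveloping XX.

(* Main.v *)
Require Import Defs.
From mathcomp Require Import all_boot all_algebra.
Set Implicit Arguments.
Unset Strict Implicit.
Unset Printing Implicit Defensive.
Import GRing.Theory.
Local Open Scope ring_scope.
Local Open Scope cat_scope.

(* Since E(Theta_j, Theta_i) = 0 for j >= i, the factors of a Theta-filtration can
   be sorted: an object is Theta-filtered iff it lies in the iterated extension
   class S_n * (S_(n-1) * (... * S_1)), where S_i consists of the finite direct
   sums of copies of Theta_i. Each S_i is functorially finite because the Hom
   modules are finitely generated. If X and Y are preenveloping and there are
   enough projectives, then X * Y is preenveloping (after Gentle and Todorov);
   precovers are obtained by applying this to the opposite category. *)

(** * Biadditivity of composition, zero objects and biproducts *)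

Section Linearity.
Variables (R : comPzRingType) (C : rcategory R).
Implicit Types W X Y Z : C.

Lemma compDl X Y Z (g g' : mor Y Z) (f : mor X Y) :
  (g + g') ∘ f = g ∘ f + g' ∘ f.
Proof. by have := compose_linear_l f 1 g g'; rewrite !scale1r. Qed.

Lemma compDr X Y Z (g : mor Y Z) (f f' : mor X Y) :
  g ∘ (f + f') = g ∘ f + g ∘ f'.
Proof. by have := compose_linear_r g 1 f f'; rewrite !scale1r. Qed.

Lemma comp0m X Y Z (f : mor X Y) : (0 : mor Y Z) ∘ f = 0.
Proof. by apply: (addrI (0 ∘ f)); rewrite -compDl !addr0. Qed.

Lemma compm0 X Y Z (g : mor Y Z) : g ∘ (0 : mor X Y) = 0.
Proof. by apply: (addrI (g ∘ 0)); rewrite -compDr !addr0. Qed.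

Lemma compNm X Y Z (g : mor Y Z) (f : mor X Y) : (- g) ∘ f = - (g ∘ f).
Proof. by apply: (addrI (g ∘ f)); rewrite -compDl !subrr comp0m. Qed.

Lemma compmN X Y Z (g : mor Y Z) (f : mor X Y) : g ∘ (- f) = - (g ∘ f).
Proof. by apply: (addrI (g ∘ f)); rewrite -compDr !subrr compm0. Qed.

Lemma compZl X Y Z r (g : mor Y Z) (f : mor X Y) : (r *: g) ∘ f = r *: (g ∘ f).
Proof. by have := compose_linear_l f r g 0; rewrite comp0m !addr0. Qed.

Definition compE := (compDl, compDr, compNm, compmN, comp0m, compm0,
  compose1m, composem1).

Lemma zero_objectP Z : idmor Z = 0 -> is_zero_object Z.
Proof.
move=> Z0 X; split=> f g.
  by rewrite -[f]composem1 -[g]composem1 Z0 !compm0.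
by rewrite -[f]compose1m -[g]compose1m Z0 !comp0m.
Qed.

Lemma zero_object_src Z X (f : mor Z X) : is_zero_object Z -> f = 0.
Proof. by case/(_ X) => + _; apply. Qed.

Lemma zero_object_tgt Z X (f : mor X Z) : is_zero_object Z -> f = 0.
Proof. by case/(_ X) => _; apply. Qed.

Definition biproduct_swap X Y (S : biproduct X Y) : biproduct Y X :=
  Biproduct (pr2_in2 S) (pr1_in1 S) (pr2_in1 S) (pr1_in2 S)
    (etrans (addrC _ _) (in_pr S)).

Lemma shear_pr2_in1 X Y (S : biproduct X Y) (b : mor X Y) :
  (pr2 S - b ∘ pr1 S) ∘ (in1 S + in2 S ∘ b) = 0.
Proof.
rewrite !compE -!(composeA b) !(composeA _ (in2 S)) pr2_in1 pr2_in2 pr1_in1.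
by rewrite pr1_in2 !compE oppr0 addr0 add0r subrr.
Qed.

Lemma shear_in_pr X Y (S : biproduct X Y) (b : mor X Y) :
  (in1 S + in2 S ∘ b) ∘ pr1 S + in2 S ∘ (pr2 S - b ∘ pr1 S) = idmor S.
Proof.
by rewrite !compE composeA addrACA subrr addr0 in_pr.
Qed.

Lemma shear_pr1_in1 X Y (S : biproduct X Y) (b : mor X Y) :
  pr1 S ∘ (in1 S + in2 S ∘ b) = idmor X.
Proof. by rewrite !compE composeA pr1_in1 pr1_in2 !compE addr0. Qed.

Lemma shear_pr2_in2 X Y (S : biproduct X Y) (b : mor X Y) :
  (pr2 S - b ∘ pr1 S) ∘ in2 S = idmor Y.
Proof. by rewrite !compE -composeA pr2_in2 pr1_in2 !compE subr0. Qed.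

(* The biproduct [S] of [X] and [Y] with [X] embedded as the graph of [b]. *)
Definition biproduct_shear X Y (S : biproduct X Y) (b : mor X Y) :
    biproduct X Y :=
  Biproduct (shear_pr1_in1 S b) (shear_pr2_in2 S b) (pr1_in2 S)
    (shear_pr2_in1 S b) (shear_in_pr S b).

Lemma zero_pr1_in1 X Z : is_zero_object Z -> (0 : mor X Z) ∘ 0 = idmor Z.
Proof. by move=> Z0; rewrite (zero_object_src (_ ∘ _) Z0) [RHS]zero_object_src. Qed.

Lemma zero_in_pr X Z :
  idmor X ∘ idmor X + (0 : mor Z X) ∘ (0 : mor X Z) = idmor X.
Proof. by rewrite !compE addr0. Qed.

(** With [X] itself as carrier, the split triangles on this biproduct and on its swap are
    [X -> X -> Z] and [Z -> X -> X], with an identity map. *)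
Definition biproduct_zero X Z (Z0 : is_zero_object Z) : biproduct X Z :=
  Biproduct (compose1m (idmor X)) (zero_pr1_in1 X Z0)
    (compose1m (0 : mor Z X)) (composem1 (0 : mor X Z)) (zero_in_pr X Z).

End Linearity.

(** * Extensions along zero morphisms and zero objects *)

Section Extensions.
Variables (R : comPzRingType) (C : rcategory R) (E : bifunctor C).

Lemma Emap0 (Z Z' A A' : C) (c : mor Z' Z) (a : mor A A') : Emap E c a 0 = 0.
Proof.
have := Emap_linear c a 1 0 (0 : E Z A); rewrite !scale1r addr0 => e.
by apply: (addrI (Emap E c a 0)); rewrite -e addr0.
Qed.

Lemma Emap0l (Z Z' A A' : C) (a : mor A A') (d : E Z A) :
  Emap E (0 : mor Z' Z) a d = 0.
Proof.
have := Emap_linear_l a d 1 0 (0 : mor Z' Z); rewrite !scale1r addr0 => e.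
by apply: (addrI (Emap E 0 a d)); rewrite -e addr0.
Qed.

Lemma Emap0r (Z Z' A A' : C) (c : mor Z' Z) (d : E Z A) :
  Emap E c (0 : mor A A') d = 0.
Proof.
have := Emap_linear_r c d 1 0 (0 : mor A A'); rewrite !scale1r addr0 => e.
by apply: (addrI (Emap E c 0 d)); rewrite -e addr0.
Qed.

Lemma ext_zero_l (Z A : C) (d : E Z A) : is_zero_object Z -> d = 0.
Proof.
by move=> Z0; rewrite -[d]Emap_id (zero_object_src (idmor Z) Z0) Emap0l.
Qed.

Lemma ext_zero_r (Z A : C) (d : E Z A) : is_zero_object A -> d = 0.
Proof.
by move=> A0; rewrite -[d]Emap_id (zero_object_src (idmor A) A0) Emap0r.
Qed.

End Extensions.

(** * Passage to the opposite category *)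

Section Opposite.
Variable R : comPzRingType.

Definition unop_biproduct (C : rcategory R) (X Y : op_cat C)
    (S : biproduct X Y) : @biproduct R C X Y :=
  @Biproduct R C X Y S (pr1 S) (pr2 S) (in1 S) (in2 S)
    (pr1_in1 S) (pr2_in2 S) (pr2_in1 S) (pr1_in2 S) (in_pr S).

Definition op_biproduct (C : rcategory R) (X Y : C)
    (S : biproduct X Y) : @biproduct R (op_cat C) X Y :=
  @Biproduct R (op_cat C) X Y S (pr1 S) (pr2 S) (in1 S) (in2 S)
    (pr1_in1 S) (pr2_in2 S) (pr2_in1 S) (pr1_in2 S) (in_pr S).

Lemma op_zero_object (C : rcategory R) (Z : C) :
  is_zero_object Z <-> @is_zero_object R (op_cat C) Z.
Proof. by split=> Z0 X; have [] := Z0 X. Qed.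

Lemma op_additive (C : rcategory R) :
  additive_category C -> additive_category (op_cat C).
Proof.
case=> -[Z Z0] bp; split; first by exists Z; apply/op_zero_object.
by move=> X Y; have [S] := bp X Y; constructor; exact: op_biproduct S.
Qed.

(** An equivalence of sequences changes direction in the opposite category, so the inverse
    isomorphism serves as the witness. *)
Lemma op_seq_equiv (C : rcategory R) (A Z B B' : C) (x : mor A B)
    (y : mor B Z) (x' : mor A B') (y' : mor B' Z) :
  seq_equiv x y x' y' <->
  @seq_equiv R (op_cat C) Z A B B' y x y' x'.
Proof.
split=> -[b [[b' [bK b'K]] bx yb]].
  exists b'; split; first by exists b.
    by change (y ∘ b' = y'); rewrite -yb -composeA b'K composem1.
  by change (b' ∘ x' = x); rewrite -bx composeA bK compose1m.
pose u : @mor R C B' B := b; pose v : @mor R C B B' := b'.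
have uv : u ∘ v = idmor B by []; have vu : v ∘ u = idmor B' by [].
have {}bx : y ∘ u = y' by []; have {}yb : u ∘ x' = x by [].
exists v; split; first by exists u.
  by rewrite -yb composeA vu compose1m.
by rewrite -bx -composeA uv composem1.
Qed.

Lemma op_additive_realization (C : rcategory R) (E : bifunctor C)
    (s : prerealization E) :
  is_additive_realization s -> is_additive_realization (op_prerealization s).
Proof.
case=> -[s1 s2] s3 s4; split; first split.
- move=> A Z d; have [B [x [y sB]]] := s1 Z A d.
  exists B, y, x => B' x' y'; split=> [/sB|] e.
    by apply/op_seq_equiv.
  by apply/sB/op_seq_equiv.
- move=> A B Z A' B' Z' d d' x y x' y' a c sd sd' e.
  have [b [b1 b2]] := s2 _ _ _ _ _ _ d' d y' x' y x c a sd' sd (esym e).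
  by exists b.
- by move=> A Z S; exact: (s3 Z A (biproduct_swap (unop_biproduct S))).
move=> A B Z A' B' Z' d d' x y x' y' SA SB SZ e sd sd' [e1 e2 e3 e4].
(* Exchanging the arguments of E transposes the matrix of components, so the two off-diagonal
   conditions trade places. *)
have := s4 _ _ _ _ _ _ d d' y x y' x' (unop_biproduct SZ) (unop_biproduct SB)
  (unop_biproduct SA) e sd sd' (And4 e1 e3 e2 e4).
by rewrite /hom_sum /= -!composeA.
Qed.

Definition op_et (C : extriangulated_category R) : extriangulated_category R :=
  @ExtriangulatedCategory R (op_cat C) (op_bifunctor (et_ext C))
    (op_prerealization (@et_real R C))
    (op_additive (et_additive C)) (op_additive_realization (et_ET2 C))
    (@et_ET3_op R C) (@et_ET4_op R C) (@et_ET3 R C) (@et_ET4 R C).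

End Opposite.

(** * E-triangles: weak cokernels, splitting and half-exactness *)

Section Triangles.
Variables (R : comPzRingType) (C : extriangulated_category R).

(** (ET3) applies to [t] as a map into the split triangle [0 -> T -> T], whose deflation is the
    identity. *)
Lemma triangle_weak_cokernel (A B Z T : C) (x : mor A B) (y : mor B Z)
    (t : mor B T) :
  E_triangle x y -> t ∘ x = 0 -> exists u : mor Z T, u ∘ y = t.
Proof.
case=> d sd tx; have [[O O0] _] := et_additive C; have [_ s0 _] := et_ET2 C.
have s1 := s0 O T (biproduct_swap (biproduct_zero T O0)).
have [|c [_ cy]] := et_ET3 sd s1 (a := 0) (b := t).
  by rewrite /= tx comp0m.
by exists c; rewrite cy compose1m.
Qed.

Lemma split_triangle (A Z : C) (S : biproduct A Z) :
  E_triangle (in1 S) (pr2 S).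
Proof. by have [_ s0 _] := et_ET2 C; exists 0. Qed.

(** The zero extension is also realized by the canonical sequence through a biproduct, whose
    structure is transported along the equivalence. *)
Lemma triangle_split (A B Z : C) (x : mor A B) (y : mor B Z) :
  (forall d : et_ext C Z A, d = 0) -> E_triangle x y ->
  exists r s, [/\ r ∘ x = idmor A, y ∘ s = idmor Z, r ∘ s = 0, y ∘ x = 0 &
    x ∘ r + s ∘ y = idmor B].
Proof.
move=> E0 [d]; rewrite (E0 d) => {d} sd.
have [[s1 _] s0 _] := et_ET2 C; have [_ /(_ A Z) [S]] := et_additive C.
have [B0 [x0 [y0 sE]]] := s1 A Z 0.
have /sE [b [[b' [b'b bb']] bx yb]] := s0 A Z S.
have /sE [c [[c' [c'c cc']] cx yc]] := sd.
exists (pr1 S ∘ b ∘ c'), (c ∘ b' ∘ in2 S).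
have c'x : c' ∘ x = x0 by rewrite -cx composeA c'c compose1m.
have yE : y = pr2 S ∘ b ∘ c'.
  by rewrite yb -yc -composeA cc' composem1.
have xE : x = c ∘ b' ∘ in1 S.
  by rewrite -bx -(composeA c) (composeA b') b'b compose1m.
have bK : b ∘ c' ∘ (c ∘ b') = idmor S.
  by rewrite composeA -(composeA b) c'c composem1.
have cK : c ∘ b' ∘ (b ∘ c') = idmor B.
  by rewrite composeA -(composeA c) b'b composem1.
have K X Y (p : mor S Y) (i : mor X S) :
    p ∘ b ∘ c' ∘ (c ∘ b' ∘ i) = p ∘ i.
  by rewrite -(composeA p) -(composeA p) (composeA (b ∘ c')) bK compose1m.
rewrite xE yE !K pr1_in1 pr2_in2 pr1_in2 pr2_in1; split=> //.
rewrite -!(composeA _ b) -!(composeA (c ∘ b')) !(composeA _ _ (b ∘ c')).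
by rewrite -compDl -compDr in_pr composem1 cK.
Qed.

Lemma triangle_split_biproduct (A B Z : C) (x : mor A B) (y : mor B Z) :
  (forall d : et_ext C Z A, d = 0) -> E_triangle x y ->
  exists S : biproduct A Z, bp_obj S = B.
Proof.
move=> E0 /(triangle_split E0) [r [s [h1 h2 h3 h4 h5]]].
by exists (Biproduct h1 h2 h3 h4 h5).
Qed.

(** Half-exactness of [E(T, -)]: by (ET4) the pullback of [d] along [e] comes from [A], and [e] has
    a section because [E(T, Z) = 0]. *)
Lemma ext_vanish_ext (T A B Z : C) (x : mor A B) (y : mor B Z) :
  E_triangle x y -> (forall d : et_ext C T A, d = 0) ->
  (forall d : et_ext C T Z, d = 0) -> forall d : et_ext C T B, d = 0.
Proof.
case=> d1 sd1 A0 Z0 d.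
have [[s1 _] _ _] := et_ET2 C; have [B0 [x0 [y0 sE]]] := s1 _ _ d.
have sd : et_real d x0 y0.
  apply/sE; exists (idmor _); rewrite compose1m composem1; split=> //.
  by exists (idmor _); rewrite compose1m.
have [Y [h' [u [e [d3 [_ _ sY _ pe]]]]]] := et_ET4 sd1 sd.
have [|r [s [_ es _ _ _]]] := @triangle_split _ _ _ u e Z0.
  by eexists; exact: sY.
have : pull s (pull e d) = d.
  by rewrite /pull -Emap_comp es compose1m Emap_id.
rewrite -pe => <-.
rewrite /pull /push -Emap_comp !compose1m -[s]composem1 -[x]composem1.
by rewrite Emap_comp (A0 (Emap _ s _ _)) Emap0.
Qed.

Lemma triangle_seq_equiv (A B B' Z : C) (x : mor A B) (y : mor B Z)
    (x' : mor A B') (y' : mor B' Z) :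
  E_triangle x y -> seq_equiv x y x' y' -> E_triangle x' y'.
Proof.
case=> d sd [b [[b' [b'b bb']] bx yb]]; exists d.
have [[s1 _] _ _] := et_ET2 C; have [B0 [x0 [y0 sE]]] := s1 _ _ d.
have /sE [c [[c' [c'c cc']] cx yc]] := sd.
apply/sE; exists (b ∘ c); split.
- exists (c' ∘ b'); split.
    by rewrite composeA -(composeA c') b'b composem1.
  by rewrite composeA -(composeA b) cc' composem1.
- by rewrite -composeA cx.
by rewrite composeA yb.
Qed.

(* (ET4) for the composition of the split inflation [K -> K (+) X0], the graph of
   [b], with the inflation [k (+) 1 : K (+) X0 -> G (+) X0]. *)
Lemma inflation_pair (K G Y0 X0 : C) (k : mor K G) (y : mor G Y0)
    (b : mor K X0) (S : biproduct G X0) :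
  E_triangle k y ->
  exists E0 (h : mor S E0) (u : mor X0 E0) (v : mor E0 Y0),
    E_triangle (in1 S ∘ k + in2 S ∘ b) h /\ E_triangle u v.
Proof.
case=> d sd; have [[O O0] /(_ K X0) [S1]] := et_additive C.
have [_ s0 s2] := et_ET2 C.
have st1 := s0 _ _ (biproduct_shear S1 b).
have sO := s0 _ _ (biproduct_zero X0 O0).
(* Since [Y0] serves as its own sum with [O], the direct sum of [d] and the zero extension is just a
   pushforward of [d]. *)
have eS : is_ext_sum d 0 (push (in1 S1) d
    : et_ext C (biproduct_zero Y0 O0) S1).
  split; rewrite /push -Emap_comp /= ?pr1_in1 ?pr2_in1 !compE ?Emap_id //.
  - exact: Emap0r.
  - exact: Emap0l.
  exact: Emap0l.
have st2 := s2 _ _ _ _ _ _ _ _ _ _ _ _ S1 S _ _ sd sO eS.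
have [E0 [h [u [v [d3 [_ st sv _ _]]]]]] := et_ET4 st1 st2.
exists E0, h, u, v; split; last by eexists; exact: sv.
exists d3; move: st; rewrite /hom_sum /= !compE.
rewrite !(composeA _ (in2 S1)) -!(composeA _ _ (in1 S1)) -!(composeA _ _ (in2 S1)).
by rewrite pr1_in1 pr2_in1 pr1_in2 pr2_in2 !compE addr0 add0r.
Qed.

End Triangles.

(** * Preenvelopes for the class of extensions of two classes *)

Definition star (R : comPzRingType) (C : extriangulated_category R)
    (XX YY : C -> Prop) (M : C) : Prop :=
  exists (X Y : C) (x : mor X M) (y : mor M Y),
    [/\ XX X, YY Y & E_triangle x y].

Lemma op_star (R : comPzRingType) (C : extriangulated_category R)
    (XX YY : C -> Prop) (M : C) :
  @star R (op_et C) YY XX M <-> star XX YY M.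
Proof. by split=> -[Y [X [y [x [hy hx sE]]]]]; exists X, Y, x, y. Qed.

Section Star.
Variables (R : comPzRingType) (C : extriangulated_category R).

(** This is [inflation_pair] read in the opposite category, keeping only its first triangle. *)
Lemma deflation_pair (K G Y0 X0 : C) (k : mor K G) (y : mor G Y0)
    (b : mor X0 Y0) (S : biproduct G X0) :
  E_triangle k y ->
  exists (E0 : C) (h : mor E0 S), E_triangle h (y ∘ pr1 S + b ∘ pr2 S).
Proof.
move=> [d sd].
have [|E0 [h [_ [_ [[d3 sd3] _]]]]] :=
  @inflation_pair R (op_et C) Y0 G K X0 y k b (op_biproduct S); first by exists d.
by exists E0, h, d3.
Qed.

(* A preenvelope [M -> Y0] is completed to a deflation [M (+) P -> Y0] by a
   projective [P]; the preenvelope of its cocone is then pushed out. *)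
Lemma star_preenveloping (XX YY : C -> Prop) :
  enough_projectives C -> preenveloping XX -> preenveloping YY ->
  preenveloping (star XX YY).
Proof.
move=> enP preX preY M.
have [Y0 [a [YY0 Ya]]] := preY M.
have [A [P [x [p [projP tP]]]]] := enP Y0.
have [_ bp] := et_additive C.
have [SP] := bp P M; have [K [k tK]] := deflation_pair a SP tP.
have [X0 [b [XX0 Xb]]] := preX K.
have [S] := bp SP X0.
have [E0 [h [u [v [th tuv]]]]] := inflation_pair b S tK.
(* [E0] is the pushout of [P (+) M] and [X0] under [K]; the triangle [X0 -> E0 -> Y0] puts it in the
   class. *)
exists E0, (h ∘ in1 S ∘ in2 SP); split; first by exists X0, Y0, u, v.
move=> M' [X [Y [i [q [XX' YY' tM']]]]] f.
have [w wE] := Ya Y YY' (q ∘ f).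
(* Projectivity of [P] extends [f] to a map [g] on [P (+) M] lying over [w]. *)
have [f' f'E] := projP _ _ _ _ _ tM' (w ∘ p).
pose g := f' ∘ pr1 SP + f ∘ pr2 SP.
have qg : q ∘ g = w ∘ (p ∘ pr1 SP + a ∘ pr2 SP).
  by rewrite !compE !composeA f'E wE.
have gM : g ∘ in2 SP = f.
  by rewrite !compE -!composeA pr1_in2 pr2_in2 !compE add0r.
move: g qg gM => g qg gM.
have [[dK sK] [d' sM']] := (tK, tM').
(* The dual of (ET3) yields the induced map [c] of cocones, which then factors through [b]. *)
have [c [_ cE]] := @et_ET3_op R C _ _ _ _ _ _ _ _ _ _ _ _ w g sM' sK qg.
have {}cE : i ∘ c = g ∘ k by exact: cE.
have [w' w'E] := Xb X XX' c.
(* The maps [g] and [i ∘ w'] agree on [K], so their difference descends to [E0]. *)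
have [|z zE] := triangle_weak_cokernel (t := g ∘ pr1 S - i ∘ w' ∘ pr2 S) th.
  rewrite !compE !composeA -!(composeA _ (pr1 S)) -!(composeA _ (pr2 S)).
  rewrite pr1_in1 pr1_in2 pr2_in1 pr2_in2 !compE oppr0 !addr0 add0r.
  by rewrite -cE -composeA w'E subrr.
exists z; rewrite !composeA zE !compE -!(composeA _ _ (in1 S)).
by rewrite pr1_in1 pr2_in1 !compE oppr0 addr0.
Qed.
End Star.

(* An alternative to [is_direct_sum] that is visibly self-dual. *)
Inductive sums (R : comPzRingType) (C : rcategory R) (T : C) : C -> Prop :=
| sums_zero Z : is_zero_object Z -> sums T Z
| sums_add N (S : biproduct N T) : sums T N -> sums T S.

Lemma op_sums (R : comPzRingType) (C : rcategory R) (T X : C) :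
  @sums R (op_cat C) T X <-> sums T X.
Proof.
split; elim=> [Z Z0|N S _ sN].
- by apply: sums_zero; apply/op_zero_object.
- exact: (sums_add (unop_biproduct S) sN).
- by apply: sums_zero; apply/op_zero_object.
exact: (@sums_add R (op_cat C) T N (op_biproduct S) sN).
Qed.

(** * Preenvelopes by finite sums of one object *)

Section Sums.
Variables (R : comPzRingType) (C : rcategory R) (T : C).

(** [f] is the column of all [v j], mapping into a sum of [m] copies of [T]. *)
Lemma sums_joint_factor (M : C) m (v : 'I_m -> mor M T) :
  additive_category C ->
  exists (X : C) (f : mor M X),
    sums T X /\ forall j, exists p : mor X T, p ∘ f = v j.
Proof.
case=> -[O O0] bp; elim: m v => [|m IH] v.
  by exists O, 0; split; [exact: sums_zero | case].
have [X [f [sX fE]]] := IH (fun j => v (lift ord0 j)).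
have [S] := bp X T; exists S, (in1 S ∘ f + in2 S ∘ v ord0); split.
  exact: sums_add.
move=> j; case: (unliftP ord0 j) => [k ->|->].
  have [p pE] := fE k; exists (p ∘ pr1 S).
  by rewrite !compE -!(composeA p) !(composeA (pr1 S)) pr1_in1 pr1_in2 !compE addr0.
by exists (pr2 S); rewrite !compE !composeA pr2_in1 pr2_in2 !compE add0r.
Qed.

Lemma sums_factor (M X : C) (f : mor M X) :
  (forall g : mor M T, exists h : mor X T, h ∘ f = g) ->
  forall X', sums T X' -> forall g : mor M X', exists h : mor X X', h ∘ f = g.
Proof.
move=> fT X'; elim=> [Z Z0|N S _ IH] g.
  by exists 0; rewrite (zero_object_tgt g Z0) comp0m.
have [h1 h1E] := IH (pr1 S ∘ g); have [h2 h2E] := fT (pr2 S ∘ g).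
exists (in1 S ∘ h1 + in2 S ∘ h2).
by rewrite compDl -!composeA h1E h2E !composeA -compDl in_pr compose1m.
Qed.

(** The column of a finite generating family of [Hom(M, T)] works, since every map [M -> T] is an
    R-combination of its entries. *)
Lemma sums_preenveloping :
  additive_category C -> (forall M : C, finitely_generated (mor M T)) ->
  preenveloping (sums T).
Proof.
move=> addC fgT M; have [m [v vE]] := fgT M.
have [X [f [sX fv]]] := sums_joint_factor v addC.
exists X, f; split=> //; apply: sums_factor => g.
have [r ->] := vE g.
elim: m v r {vE} fv => [|m IH] v r fv; first by exists 0; rewrite big_ord0 comp0m.
rewrite big_ord_recl.
have [h hE] := IH (fun j => v (lift ord0 j)) (fun j => r (lift ord0 j))
  (fun j => fv (lift ord0 j)).
have [p pE] := fv ord0.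
by exists (r ord0 *: p + h); rewrite compDl compZl pE hE.
Qed.

Lemma zero_preenveloping :
  additive_category C -> preenveloping (@is_zero_object R C).
Proof.
case=> -[O O0] _ M; exists O, 0; split=> // X X0 g; exists 0.
by rewrite (zero_object_tgt g X0) comp0m.
Qed.

End Sums.

(** * Iterated extension classes and their approximations *)

(** The layers use the indices below [n]; the largest index is the bottom layer, on the inflation
    side. *)
Fixpoint layered (R : comPzRingType) (C : extriangulated_category R)
    (Th : nat -> C) (n : nat) : C -> Prop :=
  if n is n'.+1 then star (sums (Th n')) (layered Th n')
  else @is_zero_object R C.

Lemma layered_preenveloping (R : comPzRingType) (C : extriangulated_category R)
    (Th : nat -> C) n :
  enough_projectives C -> (forall X Y : C, finitely_generated (@mor R C X Y)) ->
  preenveloping (layered Th n).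
Proof.
move=> enP fgC; have addC := et_additive C.
elim: n => [|n IH]; first exact: zero_preenveloping.
by apply: star_preenveloping => //; apply: sums_preenveloping.
Qed.

Lemma preenveloping_op (R : comPzRingType) (C : rcategory R) (XX YY : C -> Prop) :
  (forall M, XX M <-> YY M) -> @preenveloping R (op_cat C) XX -> precovering YY.
Proof.
move=> XY pre Z; have [X [f [XX0 Xf]]] := pre Z.
exists X, f; split=> [|X' YX' g]; first exact/XY.
by have [h hE] := Xf X' (proj2 (XY X') YX') g; exists h.
Qed.

Lemma precovering_op (R : comPzRingType) (C : rcategory R) (XX : C -> Prop) :
  precovering XX -> @preenveloping R (op_cat C) XX.
Proof.
move=> pre Z; have [X [f [XX0 Xf]]] := pre Z.
by exists X, f; split=> // X' YX' g; have [h hE] := Xf X' YX' g; exists h.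
Qed.

Lemma op_enough_projectives (R : comPzRingType) (C : extriangulated_category R) :
  enough_injectives C -> enough_projectives (op_et C).
Proof.
move=> enI A; have [I [Z [x [y [injI [d tI]]]]]] := enI A.
exists Z, I, y, x; split; last by exists d.
by move=> A' B' Z' x' y' [d' t'] f; apply: injI; exists d'; exact: t'.
Qed.

Lemma layered_precovering (R : comPzRingType) (C : extriangulated_category R)
    (Th : nat -> C) n :
  enough_injectives C -> (forall X Y : C, finitely_generated (@mor R C X Y)) ->
  precovering (layered Th n).
Proof.
move=> enI fgC; have addC := et_additive (op_et C).
elim: n => [|n IH].
  apply: preenveloping_op (zero_preenveloping addC) => M.
  exact: iff_sym (op_zero_object _).
(* In the opposite category the two factors of [star] change places. *)
apply: preenveloping_op (@star_preenveloping R (op_et C) (layered Th n)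
  (sums (Th n)) (op_enough_projectives enI) (precovering_op IH) _) => [M|].
  exact: op_star.
apply: precovering_op.
apply: preenveloping_op (@sums_preenveloping R (op_cat C) (Th n) addC _) => M.
  exact: op_sums.
exact: fgC.
Qed.

(** * Filtered objects and their closure under extensions *)

Section Filtered.
Variables (R : comPzRingType) (C : extriangulated_category R).

Inductive filt (XX : C -> Prop) : C -> Prop :=
| filt_zero Z : is_zero_object Z -> filt XX Z
| filt_add N M X (x : mor N M) (y : mor M X) :
    filt XX N -> XX X -> E_triangle x y -> filt XX M.

Lemma filteredP (XX : C -> Prop) M : filtered XX M <-> filt XX M.
Proof.
split=> [[m [N [X [N0 X0 <- XX1 tri]]]]|].
  have : forall i, (i <= m)%N -> filt XX (N i.+1).
    elim=> [_|i IH im].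
      (* The first triangle has zero outer terms, which forces its middle term to be zero. *)
      have [x [y t]] := tri 0%N isT.
      apply: filt_zero; apply: zero_objectP.
      have [|u <-] := triangle_weak_cokernel (t := idmor (N 1%N)) t.
        by rewrite (zero_object_src x N0) compm0.
      by rewrite (zero_object_tgt y X0) compm0.
    have [x [y t]] := tri i.+1 im.
    exact: filt_add (IH (ltnW im)) (XX1 i.+1 im) t.
  exact.
elim=> [Z Z0|{}N {}M X x y _ [m [N' [X' [N0 X0 NE XX1 tri]]]] XX2 t].
  exists 0%N, (fun=> Z), (fun=> Z); split=> //; first by case.
  case=> // _; exists (idmor Z), 0; exact: split_triangle (biproduct_zero Z Z0).
subst N.
(* The old data are kept for [N'] up to [m.+1] and for [X'] up to [m]; [M] and [X] come next. *)
exists m.+1, (fun i => if (i <= m.+1)%N then N' i else M),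
  (fun i => if (i <= m)%N then X' i else X).
split=> //; first by rewrite ltnn.
  by move=> i /andP[i0 _]; case: leqP => // im; apply: XX1; rewrite i0.
move=> i im1; rewrite im1 ltnS; case: (leqP i m) => [im|mi]; first exact: tri.
have iE : i = m.+1 by apply/eqP; rewrite eqn_leq im1.
by subst i; exists x, y.
Qed.

(** Induction on the filtration of the right-hand term: the dual of (ET4) peels off its top factor.
    When that term is zero, [x] is an isomorphism. *)
Lemma filt_star (XX : C -> Prop) M : star (filt XX) (filt XX) M -> filt XX M.
Proof.
case=> T [Q [+ [+ [fT fQ]]]]; elim: fQ M => [Z Z0|N Q' X a b _ IH XXX tab] M x y t.
  have E0 (d : et_ext C Z T) : d = 0 := ext_zero_l d Z0.
  have [r [s [rx _ _ _ rs]]] := triangle_split E0 t.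
  have xr : x ∘ r = idmor M.
    by rewrite -rs (zero_object_tgt y Z0) compm0 addr0.
  have eqv : forall N B (u : mor N T) (v : mor T B),
      E_triangle u v -> E_triangle (x ∘ u) (v ∘ r).
    move=> N B u v tuv; apply: triangle_seq_equiv tuv _.
    by exists x; split; [exists r | | rewrite -composeA rx composem1].
  clear E0 t rs.
  case: fT x r rx xr eqv => [O O0|N T' X u v fN XXX tuv] x r rx xr eqv.
    apply: filt_zero; apply: zero_objectP.
    by rewrite -xr (zero_object_src x O0) comp0m.
  exact: filt_add fN XXX (eqv _ _ _ _ tuv).
have [[d1 s1] [d2 s2]] := (tab, t).
have [Y [h' [u [v [d3 [_ t1 t2 _ _]]]]]] :=
  @et_ET4_op R C _ _ _ _ _ _ _ _ _ _ _ s1 s2.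
apply: filt_add XXX _; last by eexists; exact: t1.
by apply: IH; first by eexists; exact: t2.
Qed.

Lemma sums_filt T XX X : XX T -> sums T X -> filt XX X.
Proof.
move=> XXT; elim=> [Z Z0|N S _ fN]; first exact: filt_zero.
exact: filt_add fN XXT (split_triangle S).
Qed.

Lemma ext_vanish_sums (X T Y : C) :
  (forall d : et_ext C X T, d = 0) -> sums T Y ->
  forall d : et_ext C X Y, d = 0.
Proof.
move=> E0; elim=> [Z Z0 d|N S _ IH d]; first exact: ext_zero_r.
exact: ext_vanish_ext (split_triangle S) IH E0 d.
Qed.

(** * Sorting the factors of a filtration *)

Variable Th : nat -> C.
Hypothesis Th_ext : forall i j, (i <= j)%N ->
  forall d : et_ext C (Th j) (Th i), d = 0.

Lemma layered_filt n Y :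
  layered Th n Y -> filt (fun X => exists2 i, (i < n)%N & X = Th i) Y.
Proof.
elim: n Y => [|n IH] Y; first exact: filt_zero.
case=> X [Y' [x [y [sX lY t]]]]; apply: filt_star.
exists X, Y', x, y; split=> //; first by apply: sums_filt sX; exists n.
elim: (IH _ lY) => [Z Z0|N M X' a b _ fN [i ilt XE] tab]; first exact: filt_zero.
by apply: filt_add fN _ tab; exists i => //; apply: ltnW.
Qed.

(** All layers have index below [n], hence at most [j]; half-exactness carries the vanishing through
    them. *)
Lemma ext_vanish_layered n Y :
  layered Th n Y -> forall j, (n <= j.+1)%N ->
  forall d : et_ext C (Th j) Y, d = 0.
Proof.
elim: n Y => [|n IH] Y; first by move=> Y0 j _ d; apply: ext_zero_r.
case=> X [Y' [x [y [sX lY t]]]] j nj.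
apply: ext_vanish_ext t _ _.
  exact: ext_vanish_sums (@Th_ext n j nj) sX.
exact: IH lY _ (leqW nj).
Qed.

(* Appending a top factor [Th i]: it is absorbed by the upper layers if [i < n],
   and it commutes with them if [i = n] because the extension splits. *)
Lemma layered_add n i X M (x : mor X M) (y : mor M (Th i)) :
  (i < n)%N -> layered Th n X -> E_triangle x y -> layered Th n M.
Proof.
elim: n X M x y => [//|n IH] X M x y ilt [T [Q [a [b [sT lQ [d1 s1]]]]]] [d2 s2].
(* (ET4) gives triangles [T -> M -> Y] and [Q -> Y -> Th i], moving the new factor past the bottom
   layer [T]. *)
have [Y [h [u [v [d3 [_ t1 t2 _ _]]]]]] := et_ET4 s1 s2.
have tMY : E_triangle (x ∘ a) h by exists d3.
have tY : E_triangle u v by eexists; exact: t2.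
move: ilt; rewrite ltnS leq_eqVlt => /orP[/eqP iE|ilt]; last first.
  by exists T, Y, (x ∘ a), h; split=> //; apply: IH lQ tY.
subst i.
have E0 := ext_vanish_layered lQ (leqnSn n).
have [S SE] := triangle_split_biproduct E0 tY.
subst Y.
have [_ [d' s']] := (tMY, split_triangle (biproduct_swap S)).
(* Now the middle object is [Q (+) Th n]; pulling back along [Th n] gives [T -> Y -> Th n] and
   [Y -> M -> Q]. *)
have [Y [h' [u' [v' [d4 [_ t1' t2' _ _]]]]]] :=
  @et_ET4_op R C _ _ _ _ _ _ _ _ _ _ _ s' t1.
exists Y, Q; eexists; eexists; split; last 2 first.
- exact: lQ.
- by eexists; exact: t1'.
have t3 : @E_triangle R C _ _ _ v' u' by eexists; exact: t2'.
(* As [Th n] has no self-extensions, [Y] is [T (+) Th n], again a sum of copies of [Th n]. *)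
have [S' <-] := triangle_split_biproduct
  (ext_vanish_sums (Th_ext (leqnn n)) sT) t3.
exact: sums_add.
Qed.

Lemma filt_layered n Y :
  filt (fun X => exists2 i, (i < n)%N & X = Th i) Y -> layered Th n Y.
Proof.
elim=> [Z Z0|N M X x y _ lN [i ilt XE] t].
  elim: n => [//|n IH].
  exists Z, Z, (idmor Z), 0; split=> //; first exact: sums_zero.
  exact: split_triangle (biproduct_zero Z Z0).
subst X; exact: layered_add ilt lN t.
Qed.

End Filtered.

Theorem theorem1p3 (R : comPzRingType) (C : extriangulated_category R)
    (n : nat) (Theta : 'I_n -> C)
    (R_artinian : artinian R) (C_artin : is_artin C)
    (C_proj : enough_projectives C) (C_inj : enough_injectives C)
    (Theta_ext : forall i j : 'I_n, (i <= j)%N ->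
       forall d : et_ext C (Theta j) (Theta i), d = 0) :
  functorially_finite (filtered (family_class Theta)).
Proof.
have [[O O0] _] := et_additive C; have [fgC _ _] := C_artin.
(* The family is continued by a zero object from [n] on, which keeps the vanishing of extensions and
   allows induction over natural numbers. *)
pose Th k := if insub k is Some j then Theta j else O.
have Th_ext i j : (i <= j)%N -> forall d : et_ext C (Th j) (Th i), d = 0.
  rewrite /Th; case: insubP => [j' _ <-|_] ij d; last exact: ext_zero_l.
  move: d; case: insubP => [i' _ iE|_] d; last exact: ext_zero_r.
  by apply: Theta_ext; rewrite iE.
have FE M : layered Th n M <-> filtered (family_class Theta) M.
  have XXE X : (exists2 i, (i < n)%N & X = Th i) <-> family_class Theta X.
    split=> [[i ilt ->]|[i ->]].
      by rewrite /Th insubT; eexists.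
    by exists i => //; rewrite /Th valK.
  split=> [/layered_filt fM|/filteredP fM].
    apply/filteredP.
    elim: fM => [Z Z0|N M' X x y _ fN /XXE XX t]; first exact: filt_zero.
    exact: filt_add fN XX t.
  apply: (filt_layered Th_ext).
  elim: fM => [Z Z0|N M' X x y _ fN /XXE XX t]; first exact: filt_zero.
  exact: filt_add fN XX t.
split=> Z.
  have [X [f [lX Xf]]] := layered_precovering Th n C_inj fgC Z.
  by exists X, f; split=> [|X' /FE]; [exact/FE | exact: Xf].
have [X [f [lX Xf]]] := layered_preenveloping Th n C_proj fgC Z.
by exists X, f; split=> [|X' /FE]; [exact/FE | exact: Xf].
Qed.
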